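(* Let $f:\Omega\to\mathbb A^{n+1}$ be a non-degenerate graph immersion with parallel cubic form (that is, $\hat\nabla C=0$). Let $y\in\Omega$ be a point and let $\bullet:T_y\Omega\times T_y\Omega\to T_y\Omega$ be the multiplication $(u,v)\mapsto K(u,v)$ defined by the difference tensor $K=\nabla-\hat\nabla$ at $y$. Let $\gamma$ be the symmetric non-degenerate bilinear form defined on $T_y\Omega$ by the affine fundamental form $h$. Then $T_y\Omega$, equipped with the multiplication $\bullet$, is a real Jordan algebra $J$, and $(J,\gamma)$ is a metrised Jordan algebra.
   Context: A graph immersion $f:\Omega\to\mathbb A^{n+1}$ is a smooth hypersurface immersion of an $n$-dimensional manifold $\Omega$ into real affine space $\mathbb A^{n+1}$, equipped with a constant vector field $\xi$ transversal to $f$. With $D$ the flat connection of $\mathbb A^{n+1}$, the decomposition $D_X f_*Y=f_*(\nabla_XY)+h(X,Y)\xi$ defines the induced (flat, torsion-free) affine connection $\nabla$ and the symmetric affine fundamental form $h$ on $\Omega$. The immersion is non-degenerate if $h$ is non-degenerate; then $h$ is a pseudo-Riemannian metric (the affine metric), $\hat\nabla$ denotes its Levi-Civita connection, $C=\nabla h$ is the cubic form, and $K=\nabla-\hat\nabla$ is the difference tensor. Locally, in affine coordinates, $f$ has the form $x\mapsto(x,F(x))$ with $\xi=(\mathbf 0,1)$, and then $h_{\alpha\beta}=F_{,\alpha\beta}$, $C_{\alpha\beta\gamma}=F_{,\alpha\beta\gamma}$, $K^{\gamma}_{\alpha\beta}=-\frac12F_{,\alpha\beta\delta}F^{,\gamma\delta}$,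 where indices after a comma denote partial derivatives and $F^{,\gamma\delta}$ is the inverse of the Hessian. ''Parallel cubic form'' means $\hat\nabla C=0$. A real Jordan algebra is a finite-dimensional real vector space with a commutative bilinear product $\bullet$ satisfying $x\bullet(x^2\bullet y)=x^2\bullet(x\bullet y)$ for all $x,y$, where $x^2=x\bullet x$. A trace form on it is a symmetric bilinear form $\gamma$ with $\gamma(u\bullet v,w)=\gamma(u,v\bullet w)$ for all $u,v,w$. A pair $(J,\gamma)$ of a Jordan algebra and a non-degenerate trace form on it is called a metrised Jordan algebra. *)

(* Defs.v *)
From HB Require Import structures.
From mathcomp Require Import all_boot all_order all_algebra.
From mathcomp Require Import boolp classical_sets functions reals.
From mathcomp Require Import topology normedtype derive.

Set Implicit Arguments.
Unset Strict Implicit.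
Unset Printing Implicit Defensive.

Import Order.TTheory GRing.Theory Num.Theory.
Import numFieldNormedType.Exports.

Local Open Scope classical_set_scope.
Local Open Scope ring_scope.

Section Smooth.
Variables (R : realType) (n : nat) (W : normedModType R).

Definition partial (i : 'I_n) (g : 'rV[R]_n -> W) : 'rV[R]_n -> W :=
  'D_(delta_mx 0 i) g.

(* C^oo, for U open: g and all its iterated partial derivatives are Frechet
   differentiable (hence continuous) at every point of U. *)
Definition smooth_on (U : set 'rV[R]_n) (g : 'rV[R]_n -> W) : Prop :=
  forall (s : seq 'I_n) p, U p -> differentiable (foldr partial g s) p.

End Smooth.

(* [phi i] and [psi i] are a chart with domain [dom i] and its inverse; both are
   total functions whose values outside [dom i], resp. outside its image under
   [phi i], are irrelevant. *)
Record smooth_manifold (R : realType) (n : nat) := SmoothManifold {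
  space :> topologicalType;
  chart_index : Type;
  dom : chart_index -> set space;
  phi : chart_index -> space -> 'rV[R]_n;
  psi : chart_index -> 'rV[R]_n -> space;
  manifold_hausdorff : hausdorff_space space;
  manifold_countable : @second_countable space;
  dom_cover : forall y, exists i, dom i y;
  dom_open : forall i, open (dom i);
  img_open : forall i, open (phi i @` dom i);
  phiK : forall i y, dom i y -> psi i (phi i y) = y;
  phi_continuous : forall i, {within dom i, continuous (phi i)};
  psi_continuous : forall i, {within phi i @` dom i, continuous (psi i)};
  transition_smooth : forall i j,
    smooth_on (phi i @` (dom i `&` dom j)) (phi j \o psi i) }.

Arguments dom {R n M} i : rename.
Arguments phi {R n M} i : rename.
Arguments psi {R n M} i : rename.
Arguments img_open {R n} M i : rename.
Arguments dom_open {R n} M i : rename.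
Arguments dom_cover {R n} M y : rename.
Arguments phi_continuous {R n} M i : rename.
Arguments psi_continuous {R n} M i : rename.
Arguments transition_smooth {R n} M i j : rename.
Arguments phiK {R n M} i y : rename.

Section Manifold.
Variables (R : realType) (n : nat) (M : smooth_manifold R n).
Implicit Types (i j k : chart_index M) (y : M).

Definition img i : set 'rV[R]_n := phi i @` dom i.

Definition transition i j : 'rV[R]_n -> 'rV[R]_n := phi j \o psi i.

(* Row a of [Jac i j y] is the image of the a-th coordinate vector of chart i
   under the transition to chart j; coordinates of vectors are row vectors. *)
Definition Jac i j y : 'M[R]_n := 'J (transition i j) (phi i y).

Lemma near_dom i j y : dom i y -> dom j y ->
  \forall p \near phi i y, (phi i @` (dom i `&` dom j)) p.
Proof.
move=> iy jy.
have [ci _] : {for phi i y, continuous (psi i)} /\ True.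
  split=> //; have := psi_continuous M i.
  rewrite continuous_open_subspace; last exact: (img_open M).
  by apply; rewrite inE; exists y.
have nj : \forall p \near phi i y, dom j (psi i p).
  apply: ci; rewrite phiK //; apply: open_nbhs_nbhs; split=> //.
  exact: (dom_open M).
have ni : \forall p \near phi i y, (phi i @` dom i) p.
  by apply: open_nbhs_nbhs; split; [exact: (img_open M) | exists y].
near=> p.
have [z iz zp] : (phi i @` dom i) p by near: p.
have jz : dom j (psi i p) by near: p.
by exists z => //; split=> //; move: jz; rewrite -zp phiK.
Unshelve. all: by end_near.
Qed.

Lemma transition_differentiable i j y : dom i y -> dom j y ->
  differentiable (transition i j) (phi i y).
Proof.
by move=> iy jy; apply: (transition_smooth M i j [::]); exists y.
Qed.

Lemma transition_phi i j y : dom i y -> transition i j (phi i y) = phi j y.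
Proof. by move=> iy; rewrite /transition /= phiK. Qed.

Lemma mulmx_Jac i j y (v : 'rV[R]_n) : dom i y -> dom j y ->
  v *m Jac i j y = 'D_v (transition i j) (phi i y).
Proof.
by move=> iy jy; rewrite deriveEjacobian //; exact: transition_differentiable.
Qed.

Lemma JacM i j k y : dom i y -> dom j y -> dom k y ->
  Jac i k y = Jac i j y *m Jac j k y.
Proof.
move=> iy jy ky; apply/row_matrixP => a; rewrite 2!rowE mulmxA.
move: (delta_mx 0 a) => v.
have dij := transition_differentiable iy jy.
have djk := transition_differentiable jy ky.
rewrite -(transition_phi j iy) in djk.
have E1 : 'D_v (transition i k) (phi i y)
    = 'D_v (transition j k \o transition i j) (phi i y).
  apply: near_eq_derive.
  near=> p; have [z [iz jz] <-] : (phi i @` (dom i `&` dom j)) p.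
    by near: p; exact: near_dom.
  have T2 : transition j k (transition i j (phi i z)) = phi k z.
    by rewrite (transition_phi j iz); exact: transition_phi.
  exact: etrans (transition_phi k iz) (esym T2).
have E2 : 'D_v (transition j k \o transition i j) (phi i y)
    = 'D_('D_v (transition i j) (phi i y)) (transition j k)
        (transition i j (phi i y)).
  apply: etrans (deriveE _ (differentiable_comp dij djk)) _.
  apply: etrans (congr1 (fun g => g v) (diff_comp dij djk)) _.
  apply/esym; apply: etrans (deriveE _ djk) _.
  by rewrite (deriveE v dij).
apply: etrans (mulmx_Jac v iy ky) _; apply: etrans E1 _; apply: etrans E2 _.
apply/esym; apply: etrans (mulmx_Jac _ jy ky) _.
by rewrite (transition_phi j iy) -(mulmx_Jac v iy jy).
Unshelve. all: by end_near.
Qed.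

Lemma Jacii i y : dom i y -> Jac i i y = 1%:M.
Proof.
move=> iy; apply/row_matrixP => a; rewrite 2!rowE mulmx1.
move: (delta_mx 0 a) => v.
apply: etrans (mulmx_Jac v iy iy) _; apply: etrans (derive_id _ _).
apply: near_eq_derive.
near=> p; have [z [iz _] <-] : (phi i @` (dom i `&` dom i)) p.
  by near: p; exact: near_dom.
exact: transition_phi.
Unshelve. all: by end_near.
Qed.

End Manifold.

(* Conversion would otherwise unfold derivatives to limits. *)
Opaque Jac transition.

Section TangentSpace.
Variables (R : realType) (n : nat) (M : smooth_manifold R n) (y : M).

(* A tangent vector at y is the family of its coordinate vectors in the charts
   around y, related by the Jacobians of the transition maps; the entries at
   the other charts are set to 0. *)
Definition tangent_family : {pred (chart_index M -> 'rV[R]_n)} := fun v =>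
  `[< (forall i, ~ dom i y -> v i = 0) /\
      (forall i j, dom i y -> dom j y -> v j = v i *m Jac i j y) >].

Lemma tangent_submod_closed : GRing.submod_closed tangent_family.
Proof.
split; first by apply/asboolP; split=> // i j _ _; rewrite mul0mx.
move=> a u v /asboolP [u0 uJ] /asboolP [v0 vJ]; apply/asboolP.
have E i : (a *: u + v) i = a *: u i + v i by [].
split=> [i iy|i j iy jy]; rewrite !E.
  by rewrite (u0 _ iy) (v0 _ iy) scaler0 addr0.
by rewrite (uJ i j iy jy) (vJ i j iy jy) mulmxDl scalemxAl.
Qed.

HB.instance Definition _ := GRing.isSubmodClosed.Build R
  (chart_index M -> 'rV[R]_n) tangent_family tangent_submod_closed.

Record tangent : Type := Tangent {
  components :> chart_index M -> 'rV[R]_n;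
  _ : components \in tangent_family }.

HB.instance Definition _ := [isSub of tangent for components].
HB.instance Definition _ := [Choice of tangent by <:].
HB.instance Definition _ := [SubChoice_isSubLmodule of tangent by <:].

Lemma tangent_out (v : tangent) i : ~ dom i y -> v i = 0.
Proof. by case: v => v /= /asboolP [v0 _]; exact: v0. Qed.

Lemma tangent_change (v : tangent) i j : dom i y -> dom j y ->
  v j = v i *m Jac i j y.
Proof. by case: v => v /= /asboolP [_ vJ]; exact: vJ. Qed.

Lemma tangentP (u v : tangent) i : dom i y -> u i = v i -> u = v.
Proof.
move=> iy uv; apply/val_inj/funext => j /=.
have [jy|jy] := pselect (dom j y); last by rewrite !tangent_out.
by rewrite (tangent_change u iy jy) (tangent_change v iy jy) uv.
Qed.

Definition chart_at : chart_index M := projT1 (cid (dom_cover M y)).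

Lemma chart_atP : dom chart_at y.
Proof. exact: projT2 (cid (dom_cover M y)). Qed.

Definition extend (w : 'rV[R]_n) : chart_index M -> 'rV[R]_n := fun j =>
  if `[< dom j y >] then w *m Jac chart_at j y else 0.

Lemma extendE w j : dom j y -> extend w j = w *m Jac chart_at j y.
Proof. by move=> jy; rewrite /extend (asboolT jy). Qed.

Lemma extend_tangent w : extend w \in tangent_family.
Proof.
apply/asboolP; split=> [i iy|i j iy jy]; first by rewrite /extend (asboolF iy).
by rewrite (extendE w iy) (extendE w jy) (JacM chart_atP iy jy) mulmxA.
Qed.

Fact tangent_vect_iso : Vector.axiom n tangent.
Proof.
exists (fun v : tangent => v chart_at) => //.
exists (fun w => Tangent (extend_tangent w)) => [v|w].
  apply: (tangentP chart_atP) => /=.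
  by rewrite (extendE _ chart_atP) (Jacii chart_atP) mulmx1.
by rewrite /= (extendE _ chart_atP) (Jacii chart_atP) mulmx1.
Qed.

HB.instance Definition _ := Lmodule_hasFinDim.Build R tangent tangent_vect_iso.

End TangentSpace.

Section Connections.
Variables (R : realType) (n : nat) (M : smooth_manifold R n).
Implicit Types (i j : chart_index M) (y : M) (p : 'rV[R]_n).

(* [christoffel i p a b] is the coordinate vector of the covariant derivative of
   the b-th along the a-th coordinate field of chart i, at the point with
   coordinates p. *)
Record affine_connection := AffineConnection {
  christoffel : chart_index M -> 'rV[R]_n -> 'I_n -> 'I_n -> 'rV[R]_n;
  christoffel_smooth : forall i a b,
    smooth_on (img i) (fun p => christoffel i p a b);
  christoffel_change : forall i j y, dom i y -> dom j y -> forall a b,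
    christoffel i (phi i y) a b *m Jac i j y =
      partial a (partial b (transition i j)) (phi i y) +
      \sum_c \sum_d (Jac i j y a c * Jac i j y b d) *:
        christoffel j (phi j y) c d }.

Record covariant_2tensor := Covariant2Tensor {
  gram : chart_index M -> 'rV[R]_n -> 'M[R]_n;
  gram_smooth : forall i, smooth_on (img i) (gram i);
  gram_change : forall i j y, dom i y -> dom j y ->
    gram i (phi i y) = Jac i j y *m gram j (phi j y) *m (Jac i j y)^T }.

Implicit Types (nabla : affine_connection) (h : covariant_2tensor).

Definition christoffel_map nabla i p (u v : 'rV[R]_n) : 'rV[R]_n :=
  \sum_a \sum_b (u 0 a * v 0 b) *: christoffel nabla i p a b.

Definition tensor_map h i p (u v : 'rV[R]_n) : R := (u *m gram h i p *m v^T) 0 0.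

(* Vector fields on the domain of chart i, in coordinates. *)
Definition local_field := 'rV[R]_n -> 'rV[R]_n.
Implicit Types W X Y Z : local_field.

Definition smooth_field i X := smooth_on (img i) X.

Definition covariant_derivative nabla i X Y : local_field := fun p =>
  'D_(X p) Y p + christoffel_map nabla i p (X p) (Y p).

Definition lie_bracket X Y : local_field := fun p => 'D_(X p) Y p - 'D_(Y p) X p.

Definition tensor_fun h i Y Z : 'rV[R]_n -> R := fun p =>
  tensor_map h i p (Y p) (Z p).

(* (nabla_X h)(Y, Z) *)
Definition covariant_derivative2 nabla h i X Y Z : 'rV[R]_n -> R := fun p =>
  'D_(X p) (tensor_fun h i Y Z) p
  - tensor_fun h i (covariant_derivative nabla i X Y) Z p
  - tensor_fun h i Y (covariant_derivative nabla i X Z) p.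

(* (nabla_W C)(X, Y, Z), for a covariant 3-tensor C given as a function of local
   vector fields *)
Definition covariant_derivative3 nabla i
    (C : local_field -> local_field -> local_field -> 'rV[R]_n -> R) W X Y Z :
    'rV[R]_n -> R := fun p =>
  'D_(W p) (C X Y Z) p
  - C (covariant_derivative nabla i W X) Y Z p
  - C X (covariant_derivative nabla i W Y) Z p
  - C X Y (covariant_derivative nabla i W Z) p.

Definition torsion_free nabla : Prop := forall i X Y p,
  smooth_field i X -> smooth_field i Y -> img i p ->
  covariant_derivative nabla i X Y p - covariant_derivative nabla i Y X p
    = lie_bracket X Y p.

Definition metric_connection nabla h : Prop := forall i X Y Z p,
  smooth_field i X -> smooth_field i Y -> smooth_field i Z -> img i p ->
  covariant_derivative2 nabla h i X Y Z p = 0.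

Definition levi_civita h nabla : Prop :=
  torsion_free nabla /\ metric_connection nabla h.

Definition nondegenerate_tensor h : Prop :=
  forall i p, img i p -> gram h i p \in unitmx.

End Connections.

Section GraphImmersions.
Variables (R : realType) (n : nat) (M : smooth_manifold R n).
Implicit Types (nabla nablah : affine_connection M) (h : covariant_2tensor M).
Implicit Types (f : M -> 'rV[R]_n.+1) (xi : 'rV[R]_n.+1).

(* The affine space A^(n+1) is 'rV_(n+1) with its standard flat connection D;
   the image of the differential of f at a point is the row space of the
   Jacobian there. *)
Definition graph_immersion f xi : Prop :=
  forall i, smooth_on (img i) (f \o psi i) /\
    forall p, img i p ->
      row_free ('J (f \o psi i) p) /\ ~~ (xi <= 'J (f \o psi i) p)%MS.

(* D_X (f_* Y) = f_* (nabla_X Y) + h(X, Y) xi *)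
Definition gauss_formula f xi nabla h : Prop := forall i X Y p,
  smooth_field i X -> smooth_field i Y -> img i p ->
  'D_(X p) (fun q => Y q *m 'J (f \o psi i) q) p =
    covariant_derivative nabla i X Y p *m 'J (f \o psi i) p
    + tensor_fun h i X Y p *: xi.

Definition cubic_form nabla h i := covariant_derivative2 nabla h i.

Definition parallel_cubic_form nabla nablah h : Prop := forall i W X Y Z p,
  smooth_field i W -> smooth_field i X -> smooth_field i Y ->
  smooth_field i Z -> img i p ->
  covariant_derivative3 nablah i (cubic_form nabla h i) W X Y Z p = 0.

Section AtPoint.
Variables (nabla nablah : affine_connection M) (h : covariant_2tensor M).
Variable y : M.

(* nabla - nablah, in coordinates: the derivative terms cancel. *)
Definition difference_family (u v : tangent y) : chart_index M -> 'rV[R]_n := fun i =>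
  christoffel_map nabla i (phi i y) (u i) (v i)
  - christoffel_map nablah i (phi i y) (u i) (v i).

Lemma christoffel_map_change nb i j (u v : 'rV[R]_n) : dom i y -> dom j y ->
  christoffel_map nb i (phi i y) u v *m Jac i j y =
    (\sum_a \sum_b (u 0 a * v 0 b) *:
      partial a (partial b (transition i j)) (phi i y)) +
    christoffel_map nb j (phi j y) (u *m Jac i j y) (v *m Jac i j y).
Proof.
move=> iy jy; rewrite /christoffel_map mulmx_suml.
have -> : \sum_c \sum_d
    ((u *m Jac i j y) 0 c * (v *m Jac i j y) 0 d) *:
      christoffel nb j (phi j y) c d =
    \sum_a \sum_b (u 0 a * v 0 b) *:
      \sum_c \sum_d (Jac i j y a c * Jac i j y b d) *:
        christoffel nb j (phi j y) c d.
  under [RHS]eq_bigr => a _.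
    under eq_bigr => b _.
      rewrite scaler_sumr.
      under eq_bigr => c _.
        rewrite scaler_sumr; under eq_bigr => d _ do rewrite scalerA.
        over.
      over.
    rewrite exchange_big /=.
    under eq_bigr => c _ do rewrite exchange_big /=.
    over.
  rewrite [RHS]exchange_big /=; apply: eq_bigr => c _.
  rewrite [RHS]exchange_big /=; apply: eq_bigr => d _.
  rewrite !mxE big_distrlr /= scaler_suml; apply: eq_bigr => a _.
  by rewrite scaler_suml; apply: eq_bigr => b _; rewrite mulrACA.
rewrite -big_split /=; apply: eq_bigr => a _.
rewrite mulmx_suml -big_split /=; apply: eq_bigr => b _.
by rewrite -scalemxAl (christoffel_change nb iy jy) scalerDr.
Qed.

Lemma difference_family_tangent u v :
  difference_family u v \in tangent_family y.
Proof.
apply/asboolP; split=> [i iy|i j iy jy]; rewrite /difference_family.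
  rewrite (tangent_out u iy) /christoffel_map !big1 ?subrr // => a _;
    by apply: big1 => b _; rewrite mxE mul0r scale0r.
rewrite mulmxBl !(christoffel_map_change _ _ _ iy jy) opprD addrACA subrr add0r.
by rewrite (tangent_change u iy jy) (tangent_change v iy jy).
Qed.

Definition difference_tensor (u v : tangent y) : tangent y :=
  Tangent (difference_family_tangent u v).

(* The value does not depend on the chart, see [tensor_atE]. *)
Definition tensor_at (u v : tangent y) : R :=
  tensor_map h (chart_at y) (phi (chart_at y) y) (u (chart_at y)) (v (chart_at y)).

Lemma tensor_atE u v i : dom i y ->
  tensor_at u v = tensor_map h i (phi i y) (u i) (v i).
Proof.
move=> iy; rewrite /tensor_at /tensor_map.
rewrite (tangent_change u (chart_atP y) iy) (tangent_change v (chart_atP y) iy).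
by rewrite (gram_change h (chart_atP y) iy) trmx_mul !mulmxA.
Qed.

End AtPoint.

End GraphImmersions.

Section Jordan.
Variables (R : realType) (V : vectType R).
Implicit Types (mul : V -> V -> V) (g : V -> V -> R).

Definition jordan_algebra mul : Prop :=
  [/\ forall u, linear (mul u),
      forall v, linear (mul^~ v),
      commutative mul &
      forall x y, mul x (mul (mul x x) y) = mul (mul x x) (mul x y)].

Definition trace_form mul g : Prop :=
  [/\ forall u, scalar (g u),
      forall v, scalar (g^~ v),
      forall u v, g u v = g v u &
      forall u v w, g (mul u v) w = g u (mul v w)].

Definition nondegenerate g : Prop := forall u, (forall v, g u v = 0) -> u = 0.

Definition metrised_jordan_algebra mul g : Prop :=
  [/\ jordan_algebra mul, trace_form mul g & nondegenerate g].

End Jordan.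

(* Main.v *)
(* In a chart, the Gauss formula together with the symmetry of third derivatives
   of f gives flatness of nabla and the Codazzi equation, and the latter makes
   h (K (u, v), w) totally symmetric.  As C = - 2 h (K (., .), .), the hypothesis
   says that K is parallel for nablah.  Flatness of nabla = nablah + K then gives
   the curvature of nablah as - [K_u, K_v], while the Ricci identity for the
   parallel tensor K shows that curvature operators are derivations of K.  Hence
   every [K_u, K_v] is a derivation of the product, and a commutative algebra
   with a non-degenerate trace form and this property is a Jordan algebra. *)
Require Import Defs.
From HB Require Import structures.
From mathcomp Require Import all_boot all_order all_algebra.
From mathcomp Require Import boolp classical_sets functions reals.
From mathcomp Require Import topology normedtype derive.
From mathcomp Require Import landau interval_inference ring lra.

Set Implicit Arguments.
Unset Strict Implicit.
Unset Printing Implicit Defensive.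

Import Order.TTheory GRing.Theory Num.Theory.
Import numFieldNormedType.Exports.

Local Open Scope classical_set_scope.
Local Open Scope ring_scope.

(** * Symmetry of second directional derivatives of real functions *)

Section Young.
Variables (R : realType) (V : normedModType R).
Implicit Types (f g : V -> R) (a u v w : V).

Lemma differentiable_near f a (e : R) : differentiable f a -> 0 < e ->
  \forall k \near (0 : V), `|f (k + a) - f a - 'd f a k| <= e * `|k|.
Proof.
move=> /diff_locallyP[_ /eqaddoP fo] e0.
have := fo e e0; apply: filterS => k.
by rewrite /= opprD addrA.
Qed.

(** Both difference quotients are the same function of the increment. *)
Lemma is_derive_line f u w (t : R) (l : R) : is_derive (t *: u + w) u f l ->
  is_derive t 1 (fun s : R => f (s *: u + w)) l.
Proof.
have E : (fun h : R => h^-1 *: (((fun s : R => f (s *: u + w)) \o shift t) (h *: 1)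
      - f (t *: u + w)))
  = (fun h : R => h^-1 *: ((f \o shift (t *: u + w)) (h *: u) - f (t *: u + w))).
  apply/funext => h /=; rewrite scalerDl addrA.
  by rewrite [h *: 1]mulr1.
move=> [d dE]; split; first by rewrite /derivable E.
by rewrite /derive E.
Qed.

(** The mean value theorem for s -> f (s u + t v + a) - f (s u + a) on [0, t] turns the second
    difference into t (g (c u + t v + a) - g (c u + a)); expanding [g] to first order at [a] twice
    leaves t^2 D_v g (a) with error at most e t^2. *)
Lemma second_difference f g a u v (e : R) : 0 < e ->
  (\forall x \near a, is_derive x u f (g x)) -> differentiable g a ->
  \forall t \near (0 : R)^'+,
    `|f (t *: u + (t *: v + a)) - f (t *: u + a) - f (t *: v + a) + f a
      - t ^+ 2 * 'D_v g a| <= e * t ^+ 2.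
Proof.
move=> e0 fg dg.
(* [t * M] bounds the sum of the norms of [c *: u + t *: v] and [c *: u], the two increments at
   which [g] is expanded; the summand 1 keeps [M] positive. *)
pose M := 2 * `|u| + `|v| + 1.
have M0 : 0 < M by rewrite /M; apply: ltr_wpDl.
have eM0 : 0 < e / M by rewrite divr_gt0.
have H1 := differentiable_near dg eM0.
have {}fg : \forall k \near (0 : V), is_derive (k + a) u f (g (k + a)).
  by move: fg => /nbhs0P; apply: filterS => k; rewrite addrC.
have [r /= r0 rP] := (nbhs_normP _ _).1 (filterI H1 fg).
have {H1 fg} near_f (k : V) : `|k| < r -> is_derive (k + a) u f (g (k + a)).
  by move=> kr; apply: (rP k _).2; rewrite /ball_ /= sub0r normrN.
have near_g (k : V) : `|k| < r -> `|g (k + a) - g a - 'd g a k| <= e / M * `|k|.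
  by move=> kr; apply: (rP k _).1; rewrite /ball_ /= sub0r normrN.
near=> t.
have t0 : 0 < t by near: t; exact: nbhs_right_gt.
have tr : t * M < r.
  by rewrite -ltr_pdivlMr //; near: t; apply: nbhs_right_lt; rewrite divr_gt0.
have su (s : R) : 0 <= s <= t -> `|s *: u| <= t * `|u|.
  by move=> /andP[s0 st]; rewrite normrZ ger0_norm // ler_wpM2r.
have tv : `|t *: v| = t * `|v| by rewrite normrZ gtr0_norm.
have suvM (s : R) : 0 <= s <= t -> `|s *: u + t *: v| <= t * (`|u| + `|v|).
  by move=> /su H; rewrite (le_trans (ler_normD _ _)) // tv mulrDr lerD2r.
have M1 : t * (`|u| + `|v|) < r.
  apply: le_lt_trans tr; rewrite ler_pM2l // /M -subr_ge0.
  have := normr_ge0 u; have := normr_ge0 v; lra.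
have M2 : t * `|u| < r by apply: le_lt_trans M1; rewrite ler_pM2l // lerDl.
pose phi s := f (s *: u + (t *: v + a)) - f (s *: u + a).
pose dphi s := g (s *: u + (t *: v + a)) - g (s *: u + a).
have phi_der (s : R) : 0 <= s <= t -> is_derive s 1 phi (dphi s).
  move=> st; apply: is_deriveB; apply: is_derive_line.
    have H := near_f _ (le_lt_trans (suvM _ st) M1).
    by rewrite addrA.
  by apply: near_f; apply: le_lt_trans M2; exact: su.
have [c ct cE] : exists2 c, c \in `[0, t]%R & phi t - phi 0 = dphi c * (t - 0).
  apply: (@MVT_segment _ phi dphi); first exact: ltW.
    move=> s; rewrite in_itv /= => /andP[s0 st].
    by apply: phi_der; rewrite (ltW s0) (ltW st).
  apply: derivable_within_continuous => s; rewrite in_itv /= => st.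
  by have [] := phi_der s st.
rewrite in_itv /= in ct.
have -> : f (t *: u + (t *: v + a)) - f (t *: u + a) - f (t *: v + a) + f a
    = t * dphi c.
  have -> : t * dphi c = phi t - phi 0 by rewrite cE subr0 mulrC.
  by rewrite /phi scale0r !add0r; ring.
have A1 := near_g (c *: u + t *: v) (le_lt_trans (suvM _ ct) M1).
have A2 := near_g (c *: u) (le_lt_trans (su _ ct) M2).
have L : 'd g a (c *: u + t *: v) = 'd g a (c *: u) + t * 'D_v g a.
  by rewrite linearD [X in _ + X]linearZ (deriveE v dg).
rewrite expr2 -mulrA -mulrBr normrM gtr0_norm // mulrCA ler_pM2l // /dphi addrA.
rewrite L in A1.
set x := g (c *: u + _ + a) in A1 *; set z := g (c *: u + a) in A2 *.
have -> : x - z - t * 'D_v g a =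
  (x - g a - ('d g a (c *: u) + t * 'D_v g a)) - (z - g a - 'd g a (c *: u)) by ring.
apply: le_trans (ler_normB _ _) _; apply: le_trans (lerD A1 A2) _.
rewrite -mulrDr; apply: (@le_trans _ _ (e / M * (t * M))).
  rewrite ler_pM2l // /M; have := suvM _ ct; have := su _ ct; lra.
by rewrite mulrCA divfK ?gt_eqF // mulrC.
Unshelve. all: by end_near. Qed.

(** The second difference is symmetric in [u] and [v], so for some t > 0 both mixed derivatives
    times t^2 lie within (e / 2) t^2 of it; e is arbitrary. *)
Lemma young f gu gv a u v :
  (\forall x \near a, is_derive x u f (gu x)) ->
  (\forall x \near a, is_derive x v f (gv x)) ->
  differentiable gu a -> differentiable gv a ->
  'D_v gu a = 'D_u gv a.
Proof.
move=> fu fv du dv; apply/eqP; rewrite -subr_eq0 -normr_le0.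
apply/ler_addgt0Pr => e e0; rewrite add0r.
have e2 : 0 < e / 2 by rewrite divr_gt0.
have [t [t0 [H1 H2]]] : exists t : R, 0 < t /\
  (`|f (t *: u + (t *: v + a)) - f (t *: u + a) - f (t *: v + a) + f a
      - t ^+ 2 * 'D_v gu a| <= e / 2 * t ^+ 2 /\
   `|f (t *: v + (t *: u + a)) - f (t *: v + a) - f (t *: u + a) + f a
      - t ^+ 2 * 'D_u gv a| <= e / 2 * t ^+ 2).
  apply: (@filter_ex _ ((0 : R)^'+)); near=> t; split.
    by near: t; exact: nbhs_right_gt.
  by split; near: t; apply: second_difference.
have t2 : 0 < t ^+ 2 by rewrite exprn_gt0.
rewrite -(ler_pM2l t2) -{1}(gtr0_norm t2) -normrM.
(* This identifies the corner points of the two second differences. *)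
rewrite (addrCA (t *: v) (t *: u)) in H2.
rewrite distrC in H1.
set x := f _ in H1 H2; set y := f _ in H1 H2; set z := f _ in H1 H2.
apply: le_trans (_ : _ <= e / 2 * t ^+ 2 + e / 2 * t ^+ 2) _; last first.
  by rewrite -mulrDl -splitr mulrC.
apply: le_trans (lerD H1 H2); apply: le_trans (ler_normD _ _).
rewrite le_eqVlt; apply/orP; left; apply/eqP; congr (`|_|); ring.
Unshelve. all: by end_near. Qed.

End Young.

(** * Differentiability depends only on the germ *)

Section NearEq.
Variables (R : realType) (V W : normedModType R).
Implicit Types f g : V -> W.

Lemma differentiable_near0 f (a : V) : (\forall x \near a, f x = 0) ->
  differentiable f a.
Proof.
move=> f0; have fa0 : f a = 0 by apply: nbhs_singleton f0.
have zc : continuous (\0 : {linear V -> W}).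
  exact: (@cst_continuous V W 0).
have E : f \o shift a = cst (f a) + (\0 : {linear V -> W}) +o_ 0 id.
  apply/eqaddoP => e e0; move/nbhs0P: f0; apply: filterS => k fk0.
  by rewrite /= !fctE /= (addrC k) fk0 fa0 addr0 subr0 normr0 mulr_ge0 // ltW.
apply/diff_locallyP; rewrite (diff_unique zc E).
by [].
Qed.

(** [g] is [f] plus the function [g - f], which vanishes near [a]. *)
Lemma near_eq_differentiable f g (a : V) : (\forall x \near a, f x = g x) ->
  differentiable f a -> differentiable g a.
Proof.
move=> fg df; have -> : g = f + (g - f) by rewrite addrC subrK.
apply: (differentiableD df); apply: differentiable_near0.
by apply: filterS fg => x; rewrite !fctE => ->; rewrite subrr.
Qed.
End NearEq.

(** * Product rules for vector- and matrix-valued maps *)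

Section DeriveMatrix.
Variables (R : realType) (V : normedModType R).

Lemma derive_entry m n (F : V -> 'M[R]_(m, n)) (a v : V) i j :
  derivable F a v -> 'D_v (fun x => F x i j) a = 'D_v F a i j.
Proof. by move=> dF; rewrite (derive_mx dF) mxE. Qed.

Lemma is_deriveZmx m n (k : V -> R) (F : V -> 'M[R]_(m, n)) (a v : V) :
  derivable k a v -> derivable F a v ->
  is_derive a v (fun x => k x *: F x) ('D_v k a *: F a + k a *: 'D_v F a).
Proof.
move=> dk dF; have dFe := (derivable_mxP _ _ _).1 dF.
pose kF i j : V -> R := k * (fun x => F x i j).
have E i j : (fun x => (k x *: F x) i j) = kF i j.
  by apply/funext => x; rewrite mxE.
have dkF i j : derivable (kF i j) a v := derivableM dk (dFe i j).
have DkF i j : 'D_v (kF i j) a = _ := deriveM dk (dFe i j).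
have d : derivable (fun x => k x *: F x) a v.
  apply/derivable_mxP => i j.
  exact: (eq_ind_r (fun g => derivable g a v) (dkF i j) (E i j)).
apply: DeriveDef => //; apply/matrixP => i j; rewrite -(derive_entry _ _ d) E DkF.
rewrite (derive_entry _ _ dF) !mxE addrC; congr (_ + _); exact: mulrC.
Qed.

Lemma is_derive_sum_fun n (W : normedModType R) (F : 'I_n -> V -> W)
    (dF : 'I_n -> W) (a v : V) :
  (forall i, is_derive a v (F i) (dF i)) ->
  is_derive a v (fun x => \sum_i F i x) (\sum_i dF i).
Proof.
move=> h; have -> : (fun x => \sum_i F i x) = \sum_i F i.
  by apply/funext => x; rewrite fct_sumE.
exact: is_derive_sum.
Qed.

(* Expanding [X] in the standard basis reduces the product rule for
   [L x (X x)] to the scalar case. *)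
Lemma is_derive_linear_family n m (L : V -> 'rV[R]_n -> 'rV[R]_m)
    (X : V -> 'rV[R]_n) (a v : V) :
  (forall x, linear (L x)) -> (forall u, derivable (L^~ u) a v) ->
  derivable X a v ->
  is_derive a v (fun x => L x (X x)) ('D_v (L^~ (X a)) a + L a ('D_v X a)).
Proof.
move=> Llin dL dX.
have LE x w : L x w = \sum_j w 0 j *: L x (delta_mx 0 j).
  pose l := GRing.isLinear.Build _ _ _ _ (L x) (Llin x).
  pose L' : {linear 'rV[R]_n -> 'rV[R]_m} := HB.pack (L x) l.
  rewrite [in LHS](row_sum_delta w) -[LHS]/(L' _) linear_sum.
  by apply: eq_bigr => j _; rewrite linearZ.
have -> : (fun x => L x (X x)) =
    (fun x => \sum_j X x 0 j *: L x (delta_mx 0 j)).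
  by apply/funext => x; rewrite LE.
have dXj j : derivable (fun x => X x 0 j) a v by exact: (derivable_mxP _ _ _).1.
have H := is_derive_sum_fun (fun j => is_deriveZmx (dXj j) (dL (delta_mx 0 j))).
apply: is_derive_eq H _; rewrite big_split /= addrC; congr (_ + _); last first.
  by rewrite [RHS]LE; apply: eq_bigr => j _; rewrite derive_entry.
(* With the argument frozen at [X a] the coefficients are constants, so only the basis values
   [L x (delta_mx 0 j)] are differentiated. *)
have -> : L^~ (X a) = fun x => \sum_j X a 0 j *: L x (delta_mx 0 j).
  by apply/funext => x; rewrite LE.
apply/esym; have [] // := is_derive_sum_fun (fun j =>
  is_deriveZ (X a 0 j) (derivableP (dL (delta_mx 0 j)))).
Qed.

End DeriveMatrix.

(** * Closure properties of smooth maps on an open set *)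

Section SmoothOn.
Variables (R : realType) (n : nat) (W : normedModType R).
Variable U : set 'rV[R]_n.
Hypothesis Uo : open U.
Implicit Types f g : 'rV[R]_n -> W.

Lemma near_open p (P : 'rV[R]_n -> Prop) : U p -> (forall q, U q -> P q) ->
  \forall q \near p, P q.
Proof. by move=> Up UP; apply: filterS UP _; exact: open_nbhs_nbhs. Qed.

Lemma smooth_on_diff f p : smooth_on U f -> U p -> differentiable f p.
Proof. by move=> fs Up; exact: (fs [::]). Qed.

Lemma smooth_on_derivable f p v : smooth_on U f -> U p -> derivable f p v.
Proof. by move=> fs Up; apply: diff_derivable; exact: smooth_on_diff. Qed.

Lemma smooth_on_partial f i : smooth_on U f -> smooth_on U (partial i f).
Proof.
(* The direction [i] is applied first, hence it is the last entry of the sequence. *)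
by move=> fs s p Up; have := fs (rcons s i) p Up; rewrite foldr_rcons.
Qed.

(** Since [U] is open, equality on [U] passes to every iterated partial derivative. *)
Lemma smooth_on_eq f g : {in U, f =1 g} -> smooth_on U f -> smooth_on U g.
Proof.
move=> fg fs s.
have E : forall p, U p -> foldr (@partial R n W) f s p = foldr (@partial R n W) g s p.
  elim: s => [p Up|i s IH p Up] /=; first by apply: fg; rewrite inE.
  exact: near_eq_derive (near_open Up IH).
by move=> p Up; apply: near_eq_differentiable (near_open Up E) _; exact: fs.
Qed.

Lemma smooth_on_cst (c : W) : smooth_on U (fun=> c).
Proof.
move=> s; have [b ->] : exists b : W, foldr (@partial R n W) (fun=> c) s = (fun=> b).
  elim: s => [|i s [b /= ->]]; first by exists c.
  by exists 0; apply/funext => p; exact: derive_cst.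
by move=> p _; exact: differentiable_cst.
Qed.

Lemma smooth_on_lincomb (k : R) f g : smooth_on U f -> smooth_on U g ->
  smooth_on U (fun p => k *: f p + g p).
Proof.
move=> fs gs s.
have E : forall p, U p -> foldr (@partial R n W) (fun p => k *: f p + g p) s p
    = (k *: foldr (@partial R n W) f s + foldr (@partial R n W) g s) p.
  elim: s => [//|i s IH] p Up /=.
  transitivity (partial i (k *: foldr (@partial R n W) f s
      + foldr (@partial R n W) g s) p).
    by apply: near_eq_derive; exact: near_open Up IH.
  rewrite /partial.
  by rewrite deriveD ?deriveZ //; [exact: diff_derivable (fs _ _ _)
    |exact: derivableZ (diff_derivable (fs _ _ _))
    |exact: diff_derivable (gs _ _ _)].
move=> p Up; apply: (@near_eq_differentiable _ _ _
  (k *: foldr (@partial R n W) f s + foldr (@partial R n W) g s)).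
  by apply: near_open Up _ => q Uq; rewrite E.
by apply: differentiableD; [apply: differentiableZ; exact: fs|exact: gs].
Qed.

Lemma smooth_on_sum (I : Type) (r : seq I) (k : I -> R) (F : I -> 'rV[R]_n -> W) :
  (forall i, smooth_on U (F i)) -> smooth_on U (fun p => \sum_(i <- r) k i *: F i p).
Proof.
move=> Fs; elim: r => [|i r IH].
  by under eq_fun do rewrite big_nil; exact: smooth_on_cst.
by under eq_fun do rewrite big_cons; exact: smooth_on_lincomb.
Qed.

Lemma derive_partial f p v : differentiable f p ->
  'D_v f p = \sum_i v 0 i *: partial i f p.
Proof.
move=> df; rewrite (deriveE v df) [in LHS](row_sum_delta v) linear_sum.
by apply: eq_bigr => i _; rewrite linearZ /partial deriveE.
Qed.

(** On [U] the derivative along a fixed [v] is a combination of partial derivatives with constant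
    coefficients. *)
Lemma smooth_on_derive f v : smooth_on U f -> smooth_on U ('D_v f).
Proof.
move=> fs; apply: (@smooth_on_eq (fun p => \sum_i v 0 i *: partial i f p)).
  by move=> p; rewrite inE => Up; rewrite -derive_partial //; exact: smooth_on_diff.
by apply: smooth_on_sum => i; exact: smooth_on_partial.
Qed.

End SmoothOn.

(** * Commuting directional derivatives of smooth maps *)

Section Schwarz.
Variables (R : realType) (n m : nat) (U : set 'rV[R]_n).
Hypothesis Uo : open U.

Lemma differentiable_entry (F : 'rV[R]_n -> 'rV[R]_m) p j :
  differentiable F p -> differentiable (fun x => F x 0 j) p.
Proof.
move=> dF; exact: (differentiable_comp dF (differentiable_coord (F p) 0 j)).
Qed.

Lemma derive_comm (F : 'rV[R]_n -> 'rV[R]_m) (u v p : 'rV[R]_n) :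
  smooth_on U F -> U p -> 'D_u ('D_v F) p = 'D_v ('D_u F) p.
Proof.
move=> Fs Up.
have DFs w : smooth_on U ('D_w F) := smooth_on_derive Uo w Fs.
have DFd w : differentiable ('D_w F) p := smooth_on_diff (DFs w) Up.
apply/rowP => j.
have E w z : 'D_w (fun x => 'D_z F x 0 j) p = 'D_w ('D_z F) p 0 j.
  by apply: derive_entry; exact: smooth_on_derivable (DFs z) Up.
have Fd w : \forall x \near p,
    is_derive x w (fun x => F x 0 j) ('D_w F x 0 j).
  apply: (near_open Uo Up) => q Uq.
  have dF : derivable F q w := smooth_on_derivable Fs Uq.
  apply: DeriveDef; last exact: derive_entry.
  exact: (derivable_mxP _ _ _).1.
have Y := young (Fd v) (Fd u) (differentiable_entry j (DFd v))
  (differentiable_entry j (DFd u)).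
exact: etrans (esym (E u v)) (etrans Y (E v u)).
Qed.
End Schwarz.

(** * Algebraic identities behind the Jordan property *)

Section Algebra.
Variables (R : realType) (V : vectType R).

(* For commutative [mul] with trace form [g] put D = [L_z, L_w].  Then
   g (x (x^2 z) - x^2 (x z), w) = g (x^2, D x) because D is g-skew, and the
   derivation property gives g (x^2, D x) = - 2 g (x^2, D x). *)
Lemma jordan_of_derivation (mul : V -> V -> V) (g : V -> V -> R) :
  (forall u, linear (mul u)) -> (forall v, linear (mul^~ v)) ->
  commutative mul -> trace_form mul g -> Defs.nondegenerate g ->
  (forall z w u v, let D x := mul z (mul w x) - mul w (mul z x) in
    D (mul u v) = mul (D u) v + mul u (D v)) ->
  jordan_algebra mul.
Proof.
move=> mulr mull mulC [gr gl gC gM] gn Dmul; split=> // x z.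
have gBl a b c : g (a - b) c = g a c - g b c.
  by have := gl c (-1) b a; rewrite scaleN1r mulN1r (addrC (- b)) => ->; rewrite addrC.
have gBr a b c : g c (a - b) = g c a - g c b by rewrite gC gBl !(gC c).
have gDl a b c : g (a + b) c = g a c + g b c.
  by have := gl c 1 a b; rewrite scale1r mul1r.
have gMl a b c : g (mul a b) c = g b (mul a c) by rewrite mulC gM.
apply/eqP; rewrite -subr_eq0; apply/eqP/gn => w.
pose D a := mul z (mul w a) - mul w (mul z a).
have Dxx : D (mul x x) = mul (D x) x + mul x (D x) := Dmul z w x x.
have skew a b : g (D a) b = - g a (D b).
  by rewrite /D gBl gBr !gMl opprB.
have -> : g (mul x (mul (mul x x) z) - mul (mul x x) (mul x z)) w =
    g (mul x x) (D x).
  by rewrite gBl /D gBr gMl !gM (mulC x w) (mulC x z) (mulC (mul z x)).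
have := skew (mul x x) x; rewrite Dxx gDl.
rewrite gM gMl (gC _ (mul x x)); lra.
Qed.

Lemma additive_of_linear (n : nat) (f : 'rV[R]_n -> 'rV[R]_n) : linear f ->
  {morph f : a b / a + b} * {morph f : a / - a}.
Proof.
move=> fl; have fD : {morph f : a b / a + b}.
  by move=> a b; have := fl 1 a b; rewrite !scale1r.
split=> // a; have f0 : f 0 = 0 by apply: (addrI (f 0)); rewrite -fD !addr0.
by have := fl (-1) a 0; rewrite f0 !addr0 !scaleN1r.
Qed.

(* Difference of the two orders of second covariant derivatives of [K (u, v)]
   when [K] is parallel; [dG e w x] stands for the derivative of the Christoffel
   term [G (w, x)] in direction [e], so [r] is the curvature operator. *)
Lemma ricci_identity (n : nat) (K G : 'rV[R]_n -> 'rV[R]_n -> 'rV[R]_n)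
    (dG : 'rV[R]_n -> 'rV[R]_n -> 'rV[R]_n -> 'rV[R]_n) e w u v :
  (forall a, linear (K a)) -> (forall a, linear (K^~ a)) ->
  (forall a, linear (G a)) ->
  let dK c a b := K (G c a) b + K a (G c b) - G c (K a b) in
  let ddK c d := dK c (G d u) v + K (dG c d u) v + (dK c u (G d v) + K u (dG c d v))
    - (dG c d (K u v) + G d (dK c u v)) in
  let r x := dG e w x + G e (G w x) - (dG w e x + G w (G e x)) in
  ddK e w = ddK w e -> r (K u v) = K (r u) v + K u (r v).
Proof.
move=> Kr Kl Gr /=.
have KDl a b c : K (a + b) c = K a c + K b c by exact: (additive_of_linear (Kl c)).1.
have KNl a c : K (- a) c = - K a c by exact: (additive_of_linear (Kl c)).2.
have KDr a b c : K c (a + b) = K c a + K c b by exact: (additive_of_linear (Kr c)).1.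
have KNr a c : K c (- a) = - K c a by exact: (additive_of_linear (Kr c)).2.
have GDr a b c : G c (a + b) = G c a + G c b by exact: (additive_of_linear (Gr c)).1.
have GNr a c : G c (- a) = - G c a by exact: (additive_of_linear (Gr c)).2.
rewrite !(KNl, KDl, KNr, KDr, GNr, GDr).
(* Expanded, hypothesis and goal are linear in the same vectors, so each coordinate is a matter of
   linear arithmetic. *)
move=> /rowP E; apply/rowP => j; move: (E j); rewrite !mxE; lra.
Qed.

(* If [G + K] is flat and [K] is parallel for the symmetric [G], then the
   curvature of [G] is [- [K_e, K_w]]. *)
Lemma curvature_identity (n : nat) (K G : 'rV[R]_n -> 'rV[R]_n -> 'rV[R]_n)
    (dG : 'rV[R]_n -> 'rV[R]_n -> 'rV[R]_n -> 'rV[R]_n) e w x :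
  (forall a, linear (K a)) -> (forall a, linear (G a)) -> G e w = G w e ->
  let dK c a b := K (G c a) b + K a (G c b) - G c (K a b) in
  let GK a b := G a b + K a b in
  dG e w x + dK e w x + GK e (GK w x) = dG w e x + dK w e x + GK w (GK e x) ->
  K w (K e x) - K e (K w x) = dG e w x + G e (G w x) - (dG w e x + G w (G e x)).
Proof.
(* Symmetry makes the terms [K (G e w) x] and [K (G w e) x] coming from [dK] cancel. *)
move=> Kr Gr Gew /=; rewrite Gew.
have KDr a b c : K c (a + b) = K c a + K c b by exact: (additive_of_linear (Kr c)).1.
have GDr a b c : G c (a + b) = G c a + G c b by exact: (additive_of_linear (Gr c)).1.
rewrite !(KDr, GDr).
move=> /rowP E; apply/rowP => j; move: (E j); rewrite !mxE; lra.
Qed.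

End Algebra.

(** * Christoffel and metric maps in coordinates *)

Section TensorMaps.
Variables (R : realType) (n : nat) (M : smooth_manifold R n).
Implicit Types (nb : affine_connection M) (h : covariant_2tensor M).

Lemma christoffel_map_linearl nb i p v : linear (christoffel_map nb i p ^~ v).
Proof.
move=> k u w; rewrite /christoffel_map scaler_sumr -big_split /=.
apply: eq_bigr => a _; rewrite scaler_sumr -big_split /=; apply: eq_bigr => b _.
by rewrite !mxE mulrDl scalerDl scalerA mulrA.
Qed.

Lemma christoffel_map_linearr nb i p u : linear (christoffel_map nb i p u).
Proof.
move=> k v w; rewrite /christoffel_map scaler_sumr -big_split /=.
apply: eq_bigr => a _; rewrite scaler_sumr -big_split /=; apply: eq_bigr => b _.
by rewrite !mxE mulrDr scalerDl scalerA mulrCA.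
Qed.

Lemma tensor_map_scalarl h i p v : scalar (tensor_map h i p ^~ v).
Proof. by move=> k u w; rewrite /tensor_map !mulmxDl -!scalemxAl !mxE. Qed.

Lemma tensor_map_scalarr h i p u : scalar (tensor_map h i p u).
Proof.
by move=> k v w; rewrite /tensor_map linearP /= mulmxDr -scalemxAr !mxE.
Qed.

(** Pairing with the basis vectors reads off the entries of [u *m gram h i p], and the Gram matrix
    is invertible. *)
Lemma tensor_map_nondeg h i p u : gram h i p \in unitmx ->
  (forall v, tensor_map h i p u v = 0) -> u = 0.
Proof.
move=> hu h0; rewrite -(mulmxK hu u); set w := u *m gram h i p.
suff -> : w = 0 by rewrite mul0mx.
apply/rowP => j; have := h0 (delta_mx 0 j).
by rewrite /tensor_map -/w trmx_delta -colE !mxE.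
Qed.

Lemma christoffel_map_smooth nb i u v :
  smooth_on (img i) (fun p => christoffel_map nb i p u v).
Proof.
rewrite /christoffel_map; have Uo := @img_open _ _ M i.
under eq_fun do rewrite pair_bigA /=.
by apply: smooth_on_sum => // -[a b]; exact: christoffel_smooth.
Qed.

Lemma tensor_map_derivable h i p (X : 'rV[R]_n -> 'rV[R]_n) v w : img i p ->
  derivable X p w -> derivable (fun q => tensor_map h i q (X q) v) p w.
Proof.
move=> ip dX; have dg : derivable (gram h i) p w.
  exact: smooth_on_derivable (gram_smooth h (i:=i)) ip.
have E : (fun q => tensor_map h i q (X q) v) =
    \sum_b (\sum_a (v 0 b *: ((fun q => X q 0 a) * (fun q => gram h i q a b)))).
  apply/funext => q; rewrite /tensor_map fct_sumE mxE; apply: eq_bigr => b _.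
  rewrite fct_sumE !mxE mulr_suml; apply: eq_bigr => a _.
  by rewrite mulrC.
rewrite E; apply: derivable_sum => b; apply: derivable_sum => a.
have dXa := (derivable_mxP _ _ _).1 dX 0 a.
have dgab := (derivable_mxP _ _ _).1 dg a b.
exact: derivableZ (derivableM dXa dgab).
Qed.

End TensorMaps.

(** * Differential geometry in a fixed chart *)

Section Chart.
Variables (R : realType) (n : nat) (M : smooth_manifold R n).
Variables (f : M -> 'rV[R]_n.+1) (xi : 'rV[R]_n.+1).
Variables (nabla nablah : affine_connection M) (h : covariant_2tensor M).
Hypothesis f_imm : graph_immersion f xi.
Hypothesis f_gauss : gauss_formula f xi nabla h.
Hypothesis h_nondeg : nondegenerate_tensor h.
Hypothesis nablah_lc : levi_civita h nablah.
Hypothesis C_parallel : parallel_cubic_form nabla nablah h.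
Variable i : chart_index M.

Let U := img i.
Let Uo : open U := img_open M i.
Let F : 'rV[R]_n -> 'rV[R]_n.+1 := f \o psi i.
(** Coordinate forms of [nabla], [nablah], [h] and the difference tensor at fixed vectors: constant
    fields have zero derivative, so tensor identities are tested on them. *)
Let G p u v := christoffel_map nabla i p u v.
Let Gh p u v := christoffel_map nablah i p u v.
Let H p u v := tensor_map h i p u v.
Let K p u v := G p u v - Gh p u v.

Let F_smooth : smooth_on U F.
Proof. exact: (f_imm i).1. Qed.

Lemma smooth_field_cst u : smooth_field i (fun=> u).
Proof. exact: smooth_on_cst. Qed.

Let G_smooth u v : smooth_on U (fun p => G p u v).
Proof. exact: christoffel_map_smooth. Qed.

Let Gh_smooth u v : smooth_on U (fun p => Gh p u v).
Proof. exact: christoffel_map_smooth. Qed.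

Let K_smooth u v : smooth_on U (fun p => K p u v).
Proof.
apply: (@smooth_on_eq _ _ _ U Uo (fun p => (-1) *: Gh p u v + G p u v)).
  by move=> p _; rewrite scaleN1r addrC.
exact: smooth_on_lincomb.
Qed.

Lemma covariant_derivative_cst nb u v p :
  covariant_derivative nb i (fun=> u) (fun=> v) p = christoffel_map nb i p u v.
Proof. by rewrite /covariant_derivative derive_cst add0r. Qed.

(** The rows of the Jacobian together with [xi] are linearly independent, so tangential and
    transversal parts can be compared separately. *)
Lemma frame_inj p (a b : 'rV[R]_n) (s t : R) : U p ->
  a *m 'J F p + s *: xi = b *m 'J F p + t *: xi -> a = b /\ s = t.
Proof.
move=> Up E; have [Jfree xiJ] := (f_imm i).2 p Up.
have {}E : (a - b) *m 'J F p = (t - s) *: xi.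
  by apply/eqP; rewrite mulmxBl scalerBl subr_eq addrAC -subr_eq opprK E addrC.
have st : s = t.
  apply/eqP; apply: contraNT xiJ; rewrite eq_sym -subr_eq0 => ts.
  by rewrite -(scalerK ts xi) -E scalemx_sub // submxMl.
split=> //; move: E; rewrite st subrr scale0r => E.
by apply/eqP; rewrite -subr_eq0; apply/eqP/(row_free_inj Jfree); rewrite E mul0mx.
Qed.

Let derive2F u v p : U p -> 'D_u ('D_v F) p = G p u v *m 'J F p + H p u v *: xi.
Proof.
move=> Up; have := f_gauss (smooth_field_cst u) (smooth_field_cst v) Up.
rewrite covariant_derivative_cst => <-; apply: near_eq_derive.
apply: (near_open Uo Up) => q Uq; rewrite deriveEjacobian //.
exact: smooth_on_diff F_smooth Uq.
Qed.

(** Second derivatives of [F] commute, and the Gauss formula splits them into a tangential part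
    given by [G] and a transversal part given by [H]. *)
Lemma induced_sym u v p : U p -> G p u v = G p v u /\ H p u v = H p v u.
Proof.
move=> Up; apply: (frame_inj Up).
have E := derive_comm Uo u v F_smooth Up.
exact: etrans (esym (derive2F u v Up)) (etrans E (derive2F v u Up)).
Qed.

Let derive3F w u v p : U p ->
  'D_w ('D_u ('D_v F)) p =
    ('D_w (fun q => G q u v) p + G p w (G p u v)) *m 'J F p
    + ('D_w (fun q => H q u v) p + H p w (G p u v)) *: xi.
Proof.
move=> Up.
have dDF : derivable ('D_u ('D_v F)) p w.
  by apply: smooth_on_derivable Up; do 2! apply: smooth_on_derive => //.
have dH : derivable (fun q => H q u v) p w.
  by have := @tensor_map_derivable _ _ _ h i p (fun=> u) v w Up (derivable_cst u p w).
have dHxi : is_derive p w (fun q => H q u v *: xi) ('D_w (fun q => H q u v) p *: xi).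
  have := is_deriveZmx dH (derivable_cst xi p w).
  by rewrite derive_cst scaler0 addr0.
(* Removing the derivative of the transversal part leaves that of the tangential field with
   coordinates [G q u v], to which the Gauss formula applies again. *)
have E : 'D_w ('D_u ('D_v F)) p - 'D_w (fun q => H q u v) p *: xi =
    'D_w (fun q => G q u v *m 'J F q) p.
  have [dHx dHxE] := dHxi; rewrite -dHxE -(deriveB dDF dHx).
  apply: near_eq_derive; apply: (near_open Uo Up) => q Uq.
  by rewrite fctE /= derive2F // addrK.
have := f_gauss (smooth_field_cst w) (G_smooth u v) Up.
rewrite -/F -E => /eqP; rewrite subr_eq => /eqP ->.
by rewrite scalerDl -addrA; congr (_ + _); rewrite addrC.
Qed.

(** Third derivatives of [F] commute: the tangential part is the flatness of [nabla], the
    transversal part the Codazzi equation for [h]. *)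
Lemma flat_codazzi w u v p : U p ->
  'D_w (fun q => G q u v) p + G p w (G p u v) =
    'D_u (fun q => G q w v) p + G p u (G p w v) /\
  'D_w (fun q => H q u v) p + H p w (G p u v) =
    'D_u (fun q => H q w v) p + H p u (G p w v).
Proof.
move=> Up; apply: (frame_inj Up).
have E := derive_comm Uo w u (smooth_on_derive Uo v F_smooth) Up.
exact: etrans (esym (derive3F w u v Up)) (etrans E (derive3F u w v Up)).
Qed.

(** * The difference tensor and the cubic form *)

Let Gh_sym u v p : U p -> Gh p u v = Gh p v u.
Proof.
move=> Up.
have := nablah_lc.1 i (fun=> u) (fun=> v) p
  (smooth_field_cst u) (smooth_field_cst v) Up.
rewrite !covariant_derivative_cst /lie_bracket !derive_cst subrr.
by move/eqP; rewrite subr_eq0 => /eqP.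
Qed.

Lemma difference_sym u v p : U p -> K p u v = K p v u.
Proof. by move=> Up; rewrite /K (induced_sym u v Up).1 (Gh_sym u v Up). Qed.

Let H_sym u v p : U p -> H p u v = H p v u.
Proof. by move=> Up; exact: (induced_sym u v Up).2. Qed.

Let HDl p u v w : H p (u + v) w = H p u w + H p v w.
Proof. by have := tensor_map_scalarl h i p w 1 u v; rewrite scale1r mul1r. Qed.

Let HNl p u w : H p (- u) w = - H p u w.
Proof.
have h0 : H p 0 w = 0 by rewrite /H /tensor_map !mul0mx mxE.
have := tensor_map_scalarl h i p w (-1) u 0.
by rewrite addr0 scaleN1r mulN1r -!/(H _ _ _) h0 addr0.
Qed.

Let HBl p u v w : H p (u - v) w = H p u w - H p v w.
Proof. by rewrite HDl HNl. Qed.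

Let HBr p u v w : H p w (u - v) = H p w u - H p w v.
Proof.
have := tensor_map_scalarr h i p w (-1) v u.
by rewrite /H scaleN1r mulN1r (addrC (- v)) => ->; rewrite addrC.
Qed.

Let HDr p u v w : H p w (u + v) = H p w u + H p w v.
Proof. by have := tensor_map_scalarr h i p w 1 u v; rewrite scale1r mul1r. Qed.

(* Subtracting [(nablah_X h) (Y, Z) = 0] cancels all derivatives. *)
Lemma cubic_form_difference X Y Z p :
  smooth_field i X -> smooth_field i Y -> smooth_field i Z -> U p ->
  cubic_form nabla h i X Y Z p =
    - H p (K p (X p) (Y p)) (Z p) - H p (Y p) (K p (X p) (Z p)).
Proof.
move=> Xs Ys Zs Up; rewrite -[LHS]subr0 -(nablah_lc.2 i X Y Z p Xs Ys Zs Up).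
rewrite /cubic_form /covariant_derivative2 /tensor_fun /covariant_derivative.
rewrite -!/(H _ _ _) -!/(G _ _ _) -!/(Gh _ _ _) /K !HBl !HBr !HDl !HDr; lra.
Qed.

Lemma difference_trace u v w p : U p -> H p (K p u v) w = H p u (K p v w).
Proof.
move=> Up.
have C a b c : cubic_form nabla h i (fun=> a) (fun=> b) (fun=> c) p =
    'D_a (fun q => H q b c) p - H p (G p a b) c - H p b (G p a c).
  by rewrite /cubic_form /covariant_derivative2 /tensor_fun !covariant_derivative_cst.
(* By the Codazzi equation the cubic form takes the same value on (a, b, c) and (b, a, c); the terms
   with [K p a b] and [K p b a] agree, and the other two give the swap. *)
have S a b c : H p b (K p a c) = H p a (K p b c).
  have := C a b c; have := C b a c.
  rewrite !cubic_form_difference //; try exact: smooth_field_cst.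
  rewrite (difference_sym b a Up) (induced_sym b a Up).1.
  have [_ +] := flat_codazzi a b c Up; lra.
by rewrite (H_sym _ w Up) S (difference_sym w v Up).
Qed.

Lemma cubic_formE X Y Z p :
  smooth_field i X -> smooth_field i Y -> smooth_field i Z -> U p ->
  cubic_form nabla h i X Y Z p = - 2 * H p (K p (X p) (Y p)) (Z p).
Proof.
move=> Xs Ys Zs Up; rewrite cubic_form_difference //.
rewrite -difference_trace // (difference_sym (Y p) (X p) Up); lra.
Qed.

(** This is nablah K = 0 in coordinates. Since C = - 2 h (K (., .), .) and nablah h = 0, the
    hypothesis on C becomes h ((nablah_w K) (u, v), z) = 0 for every z, and h is non-degenerate. *)
Lemma parallel_difference w u v p : U p ->
  'D_w (fun q => K q u v) p =
    K p (Gh p w u) v + K p u (Gh p w v) - Gh p w (K p u v).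
Proof.
move=> Up; apply/eqP; rewrite -subr_eq0; apply/eqP.
apply: (tensor_map_nondeg (h_nondeg Up)) => z; rewrite -/(H _ _ _).
have cw a : covariant_derivative nablah i (fun=> w) (fun=> a) = fun q => Gh q w a.
  by apply/funext => q; rewrite covariant_derivative_cst.
have := C_parallel (smooth_field_cst w) (smooth_field_cst u) (smooth_field_cst v)
  (smooth_field_cst z) Up.
rewrite /covariant_derivative3 !cw.
rewrite !cubic_formE //; try exact: smooth_field_cst; try exact: Gh_smooth.
have -> : 'D_w (cubic_form nabla h i (fun=> u) (fun=> v) (fun=> z)) p =
    - 2 * 'D_w (fun q => H q (K q u v) z) p.
  have dHK : derivable (fun q => H q (K q u v) z) p w.
    have dK : derivable (fun q => K q u v) p w.
      exact: smooth_on_derivable (K_smooth u v) Up.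
    by have := @tensor_map_derivable _ _ _ h i p (fun q => K q u v) z w Up dK.
  rewrite -[RHS](deriveZ (- 2) dHK); apply: near_eq_derive.
  apply: (near_open Uo Up) => q Uq.
  by rewrite cubic_formE //; exact: smooth_field_cst.
(* Metric compatibility, with the field [K q u v] as first argument of [h], replaces the derivative
   of [H q (K q u v) z] by that of [K q u v]. *)
have := nablah_lc.2 i (fun=> w) (fun q => K q u v) (fun=> z) p
  (smooth_field_cst w) (K_smooth u v) (smooth_field_cst z) Up.
rewrite /covariant_derivative2 /tensor_fun covariant_derivative_cst.
rewrite /covariant_derivative -!/(H _ _ _) -!/(Gh _ _ _).
rewrite !(HDl, HBl, HNl, HDr, HBr); lra.
Qed.

Lemma difference_linearl p v : linear (K p ^~ v).
Proof.
move=> k a b; rewrite /K /G /Gh !christoffel_map_linearl scalerBr.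
by rewrite opprD addrACA.
Qed.

Lemma difference_linearr p u : linear (K p u).
Proof.
move=> k a b; rewrite /K /G /Gh !christoffel_map_linearr scalerBr.
by rewrite opprD addrACA.
Qed.

(** One more derivative of [parallel_difference], by the product rule for bilinear maps at varying
    vectors; the right-hand side has the shape [ddK e w] of [ricci_identity]. *)
Let derive2K e w u v p : U p ->
  let dK c a b := K p (Gh p c a) b + K p a (Gh p c b) - Gh p c (K p a b) in
  'D_e ('D_w (fun q => K q u v)) p =
    dK e (Gh p w u) v + K p ('D_e (fun q => Gh q w u) p) v
    + (dK e u (Gh p w v) + K p u ('D_e (fun q => Gh q w v) p))
    - ('D_e (fun q => Gh q w (K p u v)) p + Gh p w (dK e u v)).
Proof.
move=> Up dK.
have dKE a b : 'D_e (fun q => K q a b) p = dK e a b := parallel_difference e a b Up.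
have Kd a b : derivable (fun q => K q a b) p e by apply: smooth_on_derivable Up.
have Ghd a b : derivable (fun q => Gh q a b) p e by apply: smooth_on_derivable Up.
have T1 := is_derive_linear_family (fun q => difference_linearl q v)
  (fun a => Kd a v) (Ghd w u).
have T2 := is_derive_linear_family (fun q => difference_linearr q u)
  (fun a => Kd u a) (Ghd w v).
have T3 := is_derive_linear_family
  (fun q => christoffel_map_linearr nablah i q w) (fun a => Ghd w a) (Kd u v).
rewrite -!dKE.
have [_ <-] := is_deriveB (is_deriveD T1 T2) T3.
by apply: near_eq_derive; apply: (near_open Uo Up) => q Uq; exact: parallel_difference.
Qed.

(** Flatness of [nabla] identifies [D] with a curvature operator of [nablah], and commuting second
    derivatives of [K] make that operator a derivation. *)
Lemma difference_derivation w e u v p : U p ->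
  let D x := K p w (K p e x) - K p e (K p w x) in
  D (K p u v) = K p (D u) v + K p u (D v).
Proof.
move=> Up D; pose dG a b x := 'D_a (fun q => Gh q b x) p.
have DE x : D x = dG e w x + Gh p e (Gh p w x) - (dG w e x + Gh p w (Gh p e x)).
  have GE a b : G p a b = Gh p a b + K p a b by rewrite addrC subrK.
  (* [G] is [Gh] plus [K], and [parallel_difference] gives the derivative of [K]. *)
  have DG a b : 'D_a (fun q => G q b x) p = dG a b x +
      (K p (Gh p a b) x + K p b (Gh p a x) - Gh p a (K p b x)).
    have Kd : derivable (fun q => K q b x) p a by apply: smooth_on_derivable Up.
    have Ghd : derivable (fun q => Gh q b x) p a by apply: smooth_on_derivable Up.
    rewrite -(parallel_difference a b x Up) -(deriveD Ghd Kd).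
    by congr ('D_a _ p); apply/funext => q; rewrite fctE addrC subrK.
  have [E _] := flat_codazzi e w x Up.
  rewrite (DG e w) (DG w e) !GE in E.
  exact: (curvature_identity (difference_linearr p) (christoffel_map_linearr nablah i p)
    (Gh_sym e w Up) E).
have E := derive_comm Uo e w (K_smooth u v) Up.
have {}E := etrans (esym (derive2K e w u v Up)) (etrans E (derive2K w e u v Up)).
rewrite !DE.
exact: (ricci_identity (dG := dG) (difference_linearr p) (difference_linearl p)
  (christoffel_map_linearr nablah i p) E).
Qed.
End Chart.

(** * From the chart to the tangent space at [y] *)

Theorem theorem4p1 (R : realType) (n : nat) (Omega : smooth_manifold R n)
    (f : Omega -> 'rV[R]_n.+1) (xi : 'rV[R]_n.+1)
    (nabla nablah : affine_connection Omega) (h : covariant_2tensor Omega)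
    (f_imm : graph_immersion f xi)
    (f_gauss : gauss_formula f xi nabla h)
    (h_nondeg : nondegenerate_tensor h)
    (nablah_lc : levi_civita h nablah)
    (C_parallel : parallel_cubic_form nabla nablah h)
    (y : Omega) :
  jordan_algebra (difference_tensor nabla nablah (y := y)) /\
  metrised_jordan_algebra (difference_tensor nabla nablah (y := y))
    (tensor_at h (y := y)).
Proof.
(* Tangent vectors that agree in one chart around [y] are equal, so everything is checked in the
   chart used by [tensor_at]. *)
have iy := chart_atP y; set i := chart_at y in iy.
have Up : img i (phi i y) by exists y.
set mul := difference_tensor nabla nablah (y := y).
set g := tensor_at h (y := y).
pose K u v := christoffel_map nabla i (phi i y) u v
  - christoffel_map nablah i (phi i y) u v.
have mulE u v : mul u v i = K (u i) (v i) by [].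
have gE u v : g u v = tensor_map h i (phi i y) (u i) (v i) by [].
have mulr u : linear (mul u).
  move=> k v w; apply: (tangentP iy).
  rewrite -[RHS]/(k *: mul u v i + mul u w i) !mulE; exact: difference_linearr.
have mull v : linear (mul^~ v).
  move=> k u w; apply: (tangentP iy).
  rewrite -[RHS]/(k *: mul u v i + mul w v i) !mulE; exact: difference_linearl.
have mulC : commutative mul.
  move=> u v; apply: (tangentP iy); rewrite !mulE.
  exact: (difference_sym f_imm f_gauss nablah_lc).
have gtr : trace_form mul g.
  split=> [u k v w|v k u w|u v|u v w]; rewrite !gE.
  - exact: tensor_map_scalarr.
  - exact: tensor_map_scalarl.
  - exact: (induced_sym f_imm f_gauss _ _ Up).2.
  - rewrite !mulE; exact: (difference_trace f_imm f_gauss nablah_lc).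
have gnd : Defs.nondegenerate g.
  move=> u u0; apply: (tangentP iy).
  apply: (tensor_map_nondeg (h_nondeg i _ Up)) => w.
  (* Every coordinate vector in chart [i] comes from a tangent vector, so the hypothesis on [u]
     covers all [w]. *)
  have Ew : (Tangent (extend_tangent y w)) i = w.
    by rewrite /= (extendE _ iy) (Jacii iy) mulmx1.
  by rewrite -{}Ew; exact: (u0 (Tangent _)).
have J : jordan_algebra mul.
  apply: (jordan_of_derivation mulr mull mulC gtr gnd) => z w u v D.
  apply: (tangentP iy).
  exact: (difference_derivation f_imm f_gauss h_nondeg nablah_lc C_parallel
    (z i) (w i) (u i) (v i) Up).
by split.
Qed.
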